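(* There exists a TBBGSL[1-ag, 2-var, 1-alt] sentence $\varphi$ in positive normal form that is satisfiable but not elementarily satisfiable: that is, $\varphi$ is a BGSL sentence over a single agent, using two variables, all of whose subformulas have alternation number at most $1$, such that there is a turn-based CGS $\mathcal{G}$ with $\mathcal{G}\models\varphi$, but there is no turn-based CGS $\mathcal{G}$ with $\mathcal{G}\models_E\varphi$.
   Context: A CGS is $\langle \mathrm{AP}, \mathrm{Ag}, \mathrm{Ac}, \mathrm{St}, \lambda, \tau, s_0\rangle$ (finite non-empty atomic propositions and agents, non-empty actions and states, initial state $s_0$, $\lambda:\mathrm{St}\to2^{\mathrm{AP}}$, $\tau:\mathrm{St}\times\mathrm{Ac}^{\mathrm{Ag}}\to\mathrm{St}$); turn-based if there is $\mathrm{own}:\mathrm{St}\to\mathrm{Ag}$ with $\tau(s,d_1)=\tau(s,d_2)$ whenever $d_1(\mathrm{own}(s))=d_2(\mathrm{own}(s))$ (every one-agent CGS is turn-based). Tracks: finite non-empty state sequences with consecutive states $\tau$-related; $\mathrm{Trk}(s)$ those starting at $s$. $\mathrm{Str}(s)=\mathrm{Trk}(s)\to\mathrm{Ac}$. Assignments: partial maps $\mathrm{Var}\cup\mathrm{Ag}\to$ strategies; complete if defined on all agents; $\mathrm{Asg}(X,s)=X\to\mathrm{Str}(s)$. Translation $(f)_\rho(\rho')=f(\rho\cdot\rho'_{\ge1})$; $\mathrm{play}(\chi,s)$ path $\pi$ with $\pi_0=s$, $\pi_{i+1}=\tau(\pi_i,d_i)$, $d_i(a)=\chi(a)(\pi_0\cdots\pi_i)$;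 $(\chi,s)^i=((\chi)_{\pi_0\cdots\pi_i},\pi_i)$. SL: $\varphi ::= p\mid\neg\varphi\mid\varphi\wedge\varphi\mid\varphi\vee\varphi\mid X\varphi\mid\varphi U\varphi\mid\varphi R\varphi\mid\langle\langle x\rangle\rangle\varphi\mid[[x]]\varphi\mid(a,x)\varphi$; free agents/variables: atoms none; Boolean union; $X,U,R$ add all agents; quantifiers on $x$ remove $x$; $(a,x)\varphi$: $\mathrm{free}(\varphi)$ if $a\notin\mathrm{free}(\varphi)$, else $(\mathrm{free}(\varphi)\setminus\{a\})\cup\{x\}$. Classical semantics: $p$ iff $p\in\lambda(s)$; Boolean usual; $\langle\langle x\rangle\rangle\varphi$/$[[x]]\varphi$: some/all $f\in\mathrm{Str}(s)$ satisfy $\mathcal{G},\chi[x\mapsto f],s\models\varphi$; $(a,x)\varphi$ iff $\mathcal{G},\chi[a\mapsto\chi(x)],s\models\varphi$; $X,U,R$ for complete $\chi$ as in LTL along $(\chi,s)^i$; $\mathcal{G}\models\varphi$ iff $\mathcal{G},\emptyset,s_0\models\varphi$. Positive normal form: negation only on atoms. Alternation number: maximum number of quantifier switches binding variables in non-sentence subformulas, subsentences treated as atoms, vacuous quantifications ignored. Quantification prefix over finite $V$: word over $\{\langle\langle x\rangle\rangle,[[x]]:x\in V\}$ with each $x\in V$ once ($\mathrm{Qnt}(V)$); $\mathcal{E}(\wp),\mathcal{U}(\wp)$ existential/universal variables; $\mathrm{Dep}(\wp,y)$ universal variables before existential $y$. Binding prefix: word of length $|\mathrm{Ag}|$ over pairs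 $(a,x)$, each agent exactly once. BGSL: $\varphi ::= p\mid\neg\varphi\mid\varphi\wedge\varphi\mid\varphi\vee\varphi\mid X\varphi\mid\varphi U\varphi\mid\varphi R\varphi\mid\wp\psi$, $\psi ::= \flat\varphi\mid\neg\psi\mid\psi\wedge\psi\mid\psi\vee\psi$, with $\wp\in\mathrm{Qnt}(\mathrm{free}(\psi))$. It is a fragment of NGSL: $\varphi ::= p\mid\ldots\mid\wp\varphi\mid\flat\varphi$ with $\wp\varphi$ requiring $\varphi$ agent-closed and $\wp\in\mathrm{Qnt}(\mathrm{free}(\varphi))$. Dependence map for $\wp$ over $D$: $\theta:(\mathcal{U}(\wp)\to D)\to(V\to D)$ with $\theta(v)|_{\mathcal{U}(\wp)}=v$ and, for $x\in\mathcal{E}(\wp)$, $\theta(v_1)(x)=\theta(v_2)(x)$ whenever $v_1,v_2$ agree on $\mathrm{Dep}(\wp,x)$. Over $\mathrm{Str}(s)=\mathrm{Trk}(s)\to\mathrm{Ac}$, $\theta$ is elementary if there is $\tilde\theta:\mathrm{Trk}(s)\to((\mathcal{U}(\wp)\to\mathrm{Ac})\to(V\to\mathrm{Ac}))$ with $\tilde\theta(\rho)(\hat g(\rho))(x)=\theta(g)(x)(\rho)$ for all $g,x,\rho$, where $\hat g(\rho)(u)=g(u)(\rho)$. Elementary semantics $\models_E$: like $\models$ except that a subformula $\wp\psi$ holds at $s$ iff there is an elementary dependence map $\theta$ for $\wp$ over $\mathrm{Str}(s)$ with $\mathcal{G},\theta(\chi),s\models_E\psi$ for all $\chi\in\mathrm{Asg}(\mathcal{U}(\wp),s)$.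 $\mathcal{G}\models_E\varphi$ iff $\mathcal{G},\emptyset,s_0\models_E\varphi$. *)

(* Defs.v *)
From mathcomp Require Import all_boot.

Set Implicit Arguments.
Unset Strict Implicit.
Unset Printing Implicit Defensive.

(* The set of states is non-empty because of [init]. *)
Record CGS (AP Ag : finType) := {
  Ac : Type;
  St : Type;
  Ac_inhabited : inhabited Ac;
  lab : St -> {set AP};
  tau : St -> (Ag -> Ac) -> St;
  init : St
}.

Definition turn_based (AP Ag : finType) (G : CGS AP Ag) : Prop :=
  exists own : St G -> Ag, forall (s : St G) (d1 d2 : Ag -> Ac G),
    d1 (own s) = d2 (own s) -> tau s d1 = tau s d2.

Section Tracks.
Variables (AP Ag : finType) (G : CGS AP Ag).

Definition step (s t : St G) : Prop := exists d : Ag -> Ac G, tau s d = t.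

Fixpoint is_path (s : St G) (l : seq (St G)) : Prop :=
  if l is t :: l' then step s t /\ is_path t l' else True.

(* The element [l] of [Trk s] stands for the track [s :: l]: the initial
   state is not stored. *)
Definition Trk (s : St G) : Type := {l : seq (St G) | is_path s l}.

Definition trk_last (s : St G) (rho : Trk s) : St G := last s (sval rho).

Lemma is_path_nil (s : St G) : is_path s [::].
Proof. exact: I. Qed.

Lemma is_path_cat (s : St G) (l1 l2 : seq (St G)) :
  is_path s l1 -> is_path (last s l1) l2 -> is_path s (l1 ++ l2).
Proof.
elim: l1 s => [|t l1 IH] s //= [st p1] p2; split => //; exact: IH.
Qed.

Lemma is_path_step (s : St G) (d : Ag -> Ac G) : is_path s [:: tau s d].
Proof. by split => //; exists d. Qed.

Definition trk_nil (s : St G) : Trk s := exist _ [::] (is_path_nil s).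

(* [trk_cat rho rho'] is the track rho . rho'_{>= 1}. *)
Definition trk_cat (s : St G) (rho : Trk s) (rho' : Trk (trk_last rho)) :
    Trk s :=
  exist _ (sval rho ++ sval rho') (is_path_cat (proj2_sig rho) (proj2_sig rho')).

Definition trk_next (s : St G) (rho : Trk s) (d : Ag -> Ac G) : Trk s :=
  trk_cat (exist _ [:: tau (trk_last rho) d] (is_path_step (trk_last rho) d)).

Definition Str (s : St G) : Type := Trk s -> Ac G.

Definition translate (s : St G) (f : Str s) (rho : Trk s) :
    Str (trk_last rho) :=
  fun rho' => f (trk_cat rho').

Arguments translate {s} f rho _.

(* Variables are natural numbers.  An assignment is a partial map, [None]
   meaning undefined. *)
Definition asg (s : St G) : Type := (nat + Ag)%type -> option (Str s).

Definition asg_empty (s : St G) : asg s := fun _ => None.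

Definition asg_set (s : St G) (chi : asg s) (z : nat + Ag)
    (f : option (Str s)) : asg s :=
  fun z' => if z' == z then f else chi z'.

Definition asg_bind (s : St G) (chi : asg s) (ax : Ag * nat) : asg s :=
  asg_set chi (inr ax.1) (chi (inl ax.2)).

Definition asg_translate (s : St G) (chi : asg s) (rho : Trk s) :
    asg (trk_last rho) :=
  fun z => omap (fun f => translate f rho) (chi z).

Arguments asg_translate {s} chi rho _.

(* [chi] is complete, and [c] is its restriction to the agents. *)
Definition complete_by (s : St G) (chi : asg s) (c : Ag -> Str s) : Prop :=
  forall a, chi (inr a) = Some (c a).

(* [hist c i] is the prefix pi_0 ... pi_i of the play pi determined by [c]; in
   particular pi_i is [trk_last (hist c i)]. *)
Fixpoint hist (s : St G) (c : Ag -> Str s) (i : nat) : Trk s :=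
  if i is j.+1 then trk_next (hist c j) (fun a => c a (hist c j))
  else trk_nil s.

Definition state_prop : Type := forall s : St G, asg s -> Prop.

Definition holds_at (P : state_prop) (s : St G) (chi : asg s) (c : Ag -> Str s)
    (i : nat) : Prop :=
  P (trk_last (hist c i)) (asg_translate chi (hist c i)).

Definition sem_next (P : state_prop) : state_prop := fun s chi =>
  exists2 c, complete_by chi c & holds_at P chi c 1.

Definition sem_until (P Q : state_prop) : state_prop := fun s chi =>
  exists2 c, complete_by chi c &
    exists2 i, holds_at Q chi c i & forall j, j < i -> holds_at P chi c j.

Definition sem_release (P Q : state_prop) : state_prop := fun s chi =>
  exists2 c, complete_by chi c &
    forall i, holds_at Q chi c i \/ exists2 j, j < i & holds_at P chi c j.

End Tracks.

Arguments translate {AP Ag G s} f rho _.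
Arguments asg_translate {AP Ag G s} chi rho _.

Inductive quant := Exi | Uni.

Definition is_uni (q : quant) : bool := if q is Uni then true else false.

Definition dual (q : quant) : quant := if q is Uni then Exi else Uni.

Inductive SL (AP Ag : finType) : Type :=
| SAtom of AP
| SNeg of SL AP Ag
| SAnd of SL AP Ag & SL AP Ag
| SOr of SL AP Ag & SL AP Ag
| SX of SL AP Ag
| SU of SL AP Ag & SL AP Ag
| SR of SL AP Ag & SL AP Ag
| SQuant of quant & nat & SL AP Ag
| SBind of Ag & nat & SL AP Ag.

Arguments SAtom {AP Ag} _.

Section SLTheory.
Variables AP Ag : finType.
Implicit Types phi psi : SL AP Ag.

Fixpoint free phi : seq (nat + Ag) :=
  match phi with
  | SAtom _ => [::]
  | SNeg psi => free psi
  | SAnd psi1 psi2 | SOr psi1 psi2 => free psi1 ++ free psi2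
  | SX psi => free psi ++ map inr (enum Ag)
  | SU psi1 psi2 | SR psi1 psi2 =>
      free psi1 ++ free psi2 ++ map inr (enum Ag)
  | SQuant _ x psi => [seq z <- free psi | z != inl x]
  | SBind a x psi =>
      if inr a \in free psi
      then inl x :: [seq z <- free psi | z != inr a] else free psi
  end.

Definition sentence phi : bool := nilp (free phi).

Fixpoint variables phi : seq nat :=
  match phi with
  | SAtom _ => [::]
  | SNeg psi | SX psi => variables psi
  | SAnd psi1 psi2 | SOr psi1 psi2 | SU psi1 psi2 | SR psi1 psi2 =>
      variables psi1 ++ variables psi2
  | SQuant _ x psi | SBind _ x psi => x :: variables psi
  end.

Definition num_variables phi : nat := size (undup (variables phi)).

Fixpoint pnf phi : bool :=
  match phi with
  | SAtom _ => true
  | SNeg psi => if psi is SAtom _ then true else false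
  | SX psi | SQuant _ _ psi | SBind _ _ psi => pnf psi
  | SAnd psi1 psi2 | SOr psi1 psi2 | SU psi1 psi2 | SR psi1 psi2 =>
      pnf psi1 && pnf psi2
  end.

Fixpoint subformulas phi : seq (SL AP Ag) :=
  phi :: match phi with
  | SAtom _ => [::]
  | SNeg psi | SX psi | SQuant _ _ psi | SBind _ _ psi => subformulas psi
  | SAnd psi1 psi2 | SOr psi1 psi2 | SU psi1 psi2 | SR psi1 psi2 =>
      subformulas psi1 ++ subformulas psi2
  end.

Definition switch (last : option quant) (q : quant) : nat :=
  match last, q with
  | Some Exi, Uni | Some Uni, Exi => 1
  | _, _ => 0
  end.

(* [alt_from last phi] is the maximum, over the branches of [phi], of the
   number of quantifier switches, where [last] is the last non-vacuous
   quantifier met above [phi].  Proper subformulas that are sentences count as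
   atoms.  Crossing a negation dualizes [last], so that the number is that of
   the positive normal form. *)
Fixpoint alt_from (last : option quant) phi : nat :=
  match phi with
  | SAtom _ => 0
  | SNeg psi =>
      if sentence psi then 0 else alt_from (omap dual last) psi
  | SX psi | SBind _ _ psi =>
      if sentence psi then 0 else alt_from last psi
  | SAnd psi1 psi2 | SOr psi1 psi2 | SU psi1 psi2 | SR psi1 psi2 =>
      maxn (if sentence psi1 then 0 else alt_from last psi1)
           (if sentence psi2 then 0 else alt_from last psi2)
  | SQuant q x psi =>
      if sentence psi then 0
      else if inl x \in free psi then switch last q + alt_from (Some q) psi
      else alt_from last psi
  end.

Definition alt phi : nat := alt_from None phi.

Section Semantics.
Variable G : CGS AP Ag.

Fixpoint sat phi : state_prop G :=
  match phi with
  | SAtom p => fun s _ => p \in lab s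
  | SNeg psi => fun s chi => ~ sat psi chi
  | SAnd psi1 psi2 => fun s chi => sat psi1 chi /\ sat psi2 chi
  | SOr psi1 psi2 => fun s chi => sat psi1 chi \/ sat psi2 chi
  | SX psi => sem_next (sat psi)
  | SU psi1 psi2 => sem_until (sat psi1) (sat psi2)
  | SR psi1 psi2 => sem_release (sat psi1) (sat psi2)
  | SQuant Exi x psi => fun s chi =>
      exists f : Str s, sat psi (asg_set chi (inl x) (Some f))
  | SQuant Uni x psi => fun s chi =>
      forall f : Str s, sat psi (asg_set chi (inl x) (Some f))
  | SBind a x psi => fun s chi => sat psi (asg_bind chi (a, x))
  end.

Definition models phi : Prop := sat phi (asg_empty (init G)).

End Semantics.
End SLTheory.

Definition qprefix : Type := seq (quant * nat).

Definition qvars (wp : qprefix) : seq nat := unzip2 wp.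

Definition uvars (wp : qprefix) : seq nat := [seq p.2 | p <- wp & is_uni p.1].

Definition evars (wp : qprefix) : seq nat :=
  [seq p.2 | p <- wp & ~~ is_uni p.1].

Definition dep (wp : qprefix) (y : nat) : seq nat :=
  uvars (take (index y (qvars wp)) wp).

Definition bprefix (Ag : finType) : Type := seq (Ag * nat).

(* Each agent is bound exactly once; hence [fl] has length #|Ag|. *)
Definition is_bprefix (Ag : finType) (fl : bprefix Ag) : bool :=
  perm_eq (unzip1 fl) (enum Ag).

(* [BG] and [BGgoal] are the two syntactic categories phi and psi. *)
Inductive BG (AP Ag : finType) : Type :=
| BAtom of AP
| BNeg of BG AP Ag
| BAnd of BG AP Ag & BG AP Ag
| BOr of BG AP Ag & BG AP Ag
| BX of BG AP Ag
| BU of BG AP Ag & BG AP Ag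
| BR of BG AP Ag & BG AP Ag
| BQuant of qprefix & BGgoal AP Ag
with BGgoal (AP Ag : finType) : Type :=
| GBind of bprefix Ag & BG AP Ag
| GNeg of BGgoal AP Ag
| GAnd of BGgoal AP Ag & BGgoal AP Ag
| GOr of BGgoal AP Ag & BGgoal AP Ag.

Arguments BAtom {AP Ag} _.

Section BGTheory.
Variables AP Ag : finType.

Fixpoint SL_of_BG (phi : BG AP Ag) : SL AP Ag :=
  match phi with
  | BAtom p => SAtom p
  | BNeg phi => SNeg (SL_of_BG phi)
  | BAnd phi1 phi2 => SAnd (SL_of_BG phi1) (SL_of_BG phi2)
  | BOr phi1 phi2 => SOr (SL_of_BG phi1) (SL_of_BG phi2)
  | BX phi => SX (SL_of_BG phi)
  | BU phi1 phi2 => SU (SL_of_BG phi1) (SL_of_BG phi2)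
  | BR phi1 phi2 => SR (SL_of_BG phi1) (SL_of_BG phi2)
  | BQuant wp psi =>
      foldr (fun p psi => SQuant p.1 p.2 psi) (SL_of_goal psi) wp
  end
with SL_of_goal (psi : BGgoal AP Ag) : SL AP Ag :=
  match psi with
  | GBind fl phi => foldr (fun p phi => SBind p.1 p.2 phi) (SL_of_BG phi) fl
  | GNeg psi => SNeg (SL_of_goal psi)
  | GAnd psi1 psi2 => SAnd (SL_of_goal psi1) (SL_of_goal psi2)
  | GOr psi1 psi2 => SOr (SL_of_goal psi1) (SL_of_goal psi2)
  end.

(* wp \in Qnt(X): each element of [X] is a variable quantified exactly once in
   [wp], and nothing else is quantified. *)
Definition in_Qnt (wp : qprefix) (X : seq (nat + Ag)) : bool :=
  perm_eq (map inl (qvars wp)) (undup X).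

Fixpoint is_BGSL (phi : BG AP Ag) : bool :=
  match phi with
  | BAtom _ => true
  | BNeg phi | BX phi => is_BGSL phi
  | BAnd phi1 phi2 | BOr phi1 phi2 | BU phi1 phi2 | BR phi1 phi2 =>
      is_BGSL phi1 && is_BGSL phi2
  | BQuant wp psi => in_Qnt wp (free (SL_of_goal psi)) && is_BGSL_goal psi
  end
with is_BGSL_goal (psi : BGgoal AP Ag) : bool :=
  match psi with
  | GBind fl phi => is_bprefix fl && is_BGSL phi
  | GNeg psi => is_BGSL_goal psi
  | GAnd psi1 psi2 | GOr psi1 psi2 => is_BGSL_goal psi1 && is_BGSL_goal psi2
  end.

End BGTheory.

Section DependenceMaps.
Variable wp : qprefix.

Definition valuation (X : seq nat) (D : Type) : Type := {x | x \in X} -> D.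

Definition dependence_map (D : Type)
    (theta : valuation (uvars wp) D -> valuation (qvars wp) D) : Prop :=
  (forall v (u : {x | x \in uvars wp}) (x : {x | x \in qvars wp}),
     val u = val x -> theta v x = v u) /\
  (forall x : {x | x \in qvars wp}, val x \in evars wp ->
     forall v1 v2 : valuation (uvars wp) D,
     (forall u : {x | x \in uvars wp}, val u \in dep wp (val x) ->
        v1 u = v2 u) ->
     theta v1 x = theta v2 x).

Definition elementary (T A : Type)
    (theta : valuation (uvars wp) (T -> A) -> valuation (qvars wp) (T -> A)) :
    Prop :=
  exists theta' : T -> valuation (uvars wp) A -> valuation (qvars wp) A,
    forall g x rho, theta' rho (fun u => g u rho) x = theta g x rho.

End DependenceMaps.

Section ElementarySemantics.
Variables (AP Ag : finType) (G : CGS AP Ag).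

Definition asg_of (X : seq nat) (s : St G) (v : valuation X (Str s)) : asg s :=
  fun z => match z with
           | inl x => omap v (insub x)
           | inr _ => None
           end.

Fixpoint satE (phi : BG AP Ag) : state_prop G :=
  match phi with
  | BAtom p => fun s _ => p \in lab s
  | BNeg phi => fun s chi => ~ satE phi chi
  | BAnd phi1 phi2 => fun s chi => satE phi1 chi /\ satE phi2 chi
  | BOr phi1 phi2 => fun s chi => satE phi1 chi \/ satE phi2 chi
  | BX phi => sem_next (satE phi)
  | BU phi1 phi2 => sem_until (satE phi1) (satE phi2)
  | BR phi1 phi2 => sem_release (satE phi1) (satE phi2)
  | BQuant wp psi => fun s _ =>
      exists theta : valuation (uvars wp) (Str s) -> valuation (qvars wp) (Str s),
        [/\ dependence_map theta, elementary theta
          & forall chi, satE_goal psi (asg_of (theta chi))]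
  end
with satE_goal (psi : BGgoal AP Ag) : state_prop G :=
  match psi with
  | GBind fl phi => fun s chi => satE phi (foldl (@asg_bind _ _ _ s) chi fl)
  | GNeg psi => fun s chi => ~ satE_goal psi chi
  | GAnd psi1 psi2 => fun s chi => satE_goal psi1 chi /\ satE_goal psi2 chi
  | GOr psi1 psi2 => fun s chi => satE_goal psi1 chi \/ satE_goal psi2 chi
  end.

Definition modelsE (phi : BG AP Ag) : Prop := satE phi (asg_empty (init G)).

End ElementarySemantics.

(* Main.v *)
(** The sentence says that some successor [t] of the initial state has both a
    successor with [p] and one without [p], and that for every strategy [x]
    there is a strategy [y] whose play satisfies [p] at time 1 exactly when the
    play of [x] satisfies [p] at time 2.  Classically [y] may look ahead at the
    action of [x] at time 1.  In the elementary semantics the first action of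
    [y] is a function of the first action of [x] only, so two strategies [x]
    that both move to [t] and then differ on [p] force contradictory demands on
    the same first action of [y]. *)

Require Import Defs.
From mathcomp Require Import all_boot.
From Stdlib Require Import FunctionalExtensionality.

Set Implicit Arguments.
Unset Strict Implicit.

Lemma enum_unit : enum (unit : finType) = [:: tt].
Proof. by rewrite enumT unlock. Qed.

Section OneAgent.
Variables (AP : finType) (G : CGS AP unit).

(** With [tt] as the only agent, completeness forces the witness [c] of [sem_next] to be constantly
    [f]. *)
Lemma sem_next_one_agent (P : state_prop G) (s : St G) (chi : asg s)
    (f : Str s) :
  chi (inr tt) = Some f -> sem_next P chi <-> holds_at P chi (fun=> f) 1.
Proof.
move=> chif; split=> [[c cc]|H]; last by exists (fun=> f) => // -[].
suff -> : c = fun=> f by [].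
by apply: functional_extensionality => -[]; move: (cc tt); rewrite chif => -[].
Qed.

Definition next_state (s : St G) (f : Str s) : St G :=
  tau s (fun=> f (trk_nil s)).

(** The track is written as [trk_cat] of a trivial extension so that this is, by conversion, the
    [next_state] of [f] translated along its one-step history. *)
Definition next2_state (s : St G) (f : Str s) : St G :=
  tau (next_state f)
    (fun=> f (trk_cat (trk_nil (trk_last (hist (fun=> f) 1))))).

Lemma sem_next_state (Q : St G -> Prop) (s : St G) (chi : asg s) (f : Str s) :
  chi (inr tt) = Some f ->
  sem_next (fun s _ => Q s) chi <-> Q (next_state f).
Proof. by move/(sem_next_one_agent (fun s _ => Q s)). Qed.

Lemma sem_next2_state (Q : St G -> Prop) (s : St G) (chi : asg s) (f : Str s) :
  chi (inr tt) = Some f ->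
  sem_next (sem_next (fun s _ => Q s)) chi <-> Q (next2_state f).
Proof.
move=> chif; apply: iff_trans (sem_next_one_agent _ chif) _.
have chif1 : asg_translate chi (hist (fun=> f) 1) (inr tt) =
    Some (translate f (hist (fun=> f) 1)) by rewrite /asg_translate chif.
exact: (sem_next_state Q chif1).
Qed.

Lemma asg_of_var (X : seq nat) (s : St G) (v : valuation X (Str s)) (x : nat)
    (Xx : x \in X) :
  asg_of v (inl x) = Some (v (exist _ x Xx)).
Proof. by rewrite /asg_of insubT. Qed.

Definition steer (s : St G) (a b : Ac G) : Str s :=
  fun rho => if sval rho is [::] then a else b.

End OneAgent.

Definition goal (x : nat) (phi : BG unit unit) : BGgoal unit unit :=
  GBind [:: (tt, x)] phi.

Definition p : BG unit unit := BAtom tt.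

(** Variable 0 is reused in each closed subformula, which keeps the number of variables at two. *)
Definition branching : BG unit unit :=
  BAnd (BQuant [:: (Exi, 0)] (goal 0 (BX p)))
       (BQuant [:: (Exi, 0)] (goal 0 (BX (BNeg p)))).

(** The equivalence is spelled out as a disjunction with negation on atoms only, as positive normal
    form demands. *)
Definition lookahead : BG unit unit :=
  BQuant [:: (Uni, 0); (Exi, 1)]
    (GOr (GAnd (goal 0 (BX (BX p))) (goal 1 (BX p)))
         (GAnd (goal 0 (BX (BX (BNeg p)))) (goal 1 (BX (BNeg p))))).

Definition lookahead_sentence : BG unit unit :=
  BAnd (BQuant [:: (Exi, 0)] (goal 0 (BX branching))) lookahead.

Lemma lookahead_sentence_syntax :
  let phi := lookahead_sentence in
  [/\ is_BGSL phi, sentence (SL_of_BG phi), pnf (SL_of_BG phi),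
      num_variables (SL_of_BG phi) = 2
    & all (fun psi => alt psi <= 1) (subformulas (SL_of_BG phi))].
Proof.
rewrite /alt; split=> //=.
all: by rewrite /in_Qnt /is_bprefix /sentence /= ?enum_unit.
Qed.

Definition echo_CGS : CGS unit unit := {|
  Ac := bool;
  St := bool;
  Ac_inhabited := inhabits true;
  lab := fun s => if s then setT else set0;
  tau := fun _ d => d tt;
  init := false
|}.

Lemma in_lab_echo_CGS (b : St echo_CGS) : (tt \in lab b) = b.
Proof. by case: b; rewrite inE. Qed.

Lemma echo_CGS_models : models echo_CGS (SL_of_BG lookahead_sentence).
Proof.
have next_p := @sem_next_state _ echo_CGS (fun s => tt \in lab s).
have next_np := @sem_next_state _ echo_CGS (fun s => ~ tt \in lab s).
have next2_p := @sem_next2_state _ echo_CGS (fun s => tt \in lab s).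
have next2_np := @sem_next2_state _ echo_CGS (fun s => ~ tt \in lab s).
split.
  exists (fun=> true).
  apply/(@sem_next_one_agent _ echo_CGS _ _ _ (fun=> true)) => //; split.
    by exists (fun=> true); apply/(next_p _ _ (fun=> true));
      rewrite ?in_lab_echo_CGS.
  by exists (fun=> false); apply/(next_np _ _ (fun=> false));
    rewrite ?in_lab_echo_CGS.
(* Actions of [echo_CGS] are the next states, so [y] moves at once to where [x] arrives at time
   2. *)
move=> f; exists (fun=> next2_state f); set b := next2_state f.
have [bT|bF] : b \/ ~ b by case: (b); [left|right].
  left; split; first by apply/(next2_p _ _ f); rewrite ?in_lab_echo_CGS.
  by apply/(next_p _ _ (fun=> b)); rewrite ?in_lab_echo_CGS.
right; split; first by apply/(next2_np _ _ f); rewrite ?in_lab_echo_CGS.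
by apply/(next_np _ _ (fun=> b)); rewrite ?in_lab_echo_CGS.
Qed.

(** There are no universal variables, so [theta] may be applied to any valuation, and its value at
    [x] is the strategy sought. *)
Lemma satE_exi_goal (G : CGS unit unit) (s : St G) (chi : asg s)
    (x : nat) (phi : BG unit unit) :
  satE (BQuant [:: (Exi, x)] (goal x phi)) chi ->
  exists (f : Str s) (chi' : asg s), chi' (inr tt) = Some f /\ satE phi chi'.
Proof.
have [a] := Ac_inhabited G; have xx : x \in qvars [:: (Exi, x)] by rewrite inE.
case=> theta [_ _ /(_ (fun=> fun=> a)) sat_phi].
eexists; eexists; split; last exact: sat_phi.
exact: (asg_of_var _ xx).
Qed.

Lemma not_modelsE_lookahead_sentence (G : CGS unit unit) :
  ~ modelsE G lookahead_sentence.
Proof.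
set s := init G => -[sat1 [theta [[theta_u _] [theta' theta'E] sat_goal]]].
have next_p := @sem_next_state _ G (fun s => tt \in lab s).
have next_np := @sem_next_state _ G (fun s => ~ tt \in lab s).
have [f [chi [chif sat2]]] :=
  @satE_exi_goal G s (asg_empty _) 0 (BX branching) sat1.
have [sat_p sat_np] := (sem_next_one_agent (satE branching) chif).1 sat2.
have [g [chi1 [chi1g /(next_p _ _ _ chi1g) gp]]] :=
  @satE_exi_goal G _ (asg_empty _) 0 (BX p) sat_p.
have [h [chi2 [chi2h /(next_np _ _ _ chi2h) hp]]] :=
  @satE_exi_goal G _ (asg_empty _) 0 (BX (BNeg p)) sat_np.
set wp := [:: (Uni, 0); (Exi, 1)] in theta theta_u theta' theta'E sat_goal *.
pose y : {x | x \in qvars wp} := exist _ 1 isT.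
pose u : {x | x \in uvars wp} := exist _ 0 isT.
(* [F b] lets [x] move to the branching state as [f] does and then play [b]. *)
pose F b : valuation (uvars wp) (Str s) := fun=> steer (f (trk_nil s)) b.
have bind_x b : asg_bind (asg_of (theta (F b))) (tt, 0) (inr tt) =
    Some (steer (f (trk_nil s)) b).
  by rewrite /asg_bind /asg_set eqxx (asg_of_var _ (isT : 0 \in qvars wp))
    (theta_u _ u).
have bind_y b : asg_bind (asg_of (theta (F b))) (tt, 1) (inr tt) =
    Some (theta (F b) y).
  by rewrite /asg_bind /asg_set eqxx (asg_of_var _ (isT : 1 \in qvars wp)).
(* By elementarity this action depends only on the value of [F b] at [trk_nil s], which is the same
   for all [b]. *)
have y_const b c : theta (F b) y (trk_nil s) = theta (F c) y (trk_nil s).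
  by rewrite -!theta'E.
(* The first action of [g] takes [x] to a state with [p], which refutes the second disjunct. *)
have y_p : tt \in lab (next_state (theta (F (g (trk_nil _))) y)).
  case: (sat_goal (F (g (trk_nil _)))) => -[].
    by move=> _ /(next_p _ _ _ (bind_y _)).
  by move=> /(sem_next2_state (fun s => ~ tt \in lab s) (bind_x _)) /(_ gp).
(* With [h] the first disjunct fails instead, so [y] must avoid [p] with the very action that
   reached it in [y_p]. *)
case: (sat_goal (F (h (trk_nil _)))) => -[].
  by move=> /(sem_next2_state (fun s => tt \in lab s) (bind_x _)) /hp.
move=> _ /(next_np _ _ _ (bind_y _)); apply.
by move: y_p; rewrite /next_state (y_const _ (h (trk_nil _))).
Qed.

Theorem theorem4p17 :
  exists (AP Ag : finType) (phi : BG AP Ag),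
    [/\ 0 < #|AP|, #|Ag| = 1, is_BGSL phi & sentence (SL_of_BG phi)] /\
    [/\ pnf (SL_of_BG phi),
        num_variables (SL_of_BG phi) = 2
      & all (fun psi => alt psi <= 1) (subformulas (SL_of_BG phi))] /\
    (exists G : CGS AP Ag, turn_based G /\ models G (SL_of_BG phi)) /\
    ~ (exists G : CGS AP Ag, turn_based G /\ modelsE G phi).
Proof.
exists unit, unit, lookahead_sentence.
have [? ? ? ? ?] := lookahead_sentence_syntax.
split; [by rewrite card_unit | do 2!split=> //].
  by exists echo_CGS; split; [exists (fun=> tt) | exact: echo_CGS_models].
by case=> G [_ /not_modelsE_lookahead_sentence].
Qed.
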